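(* There exist a universal polynomial $P$ in two variables and a universal constant $C>0$ (not depending on $m$, $K$ or $\alpha(\boldsymbol\phi,\mathcal P,\mathcal D)$) such that the following holds in the scrip-system model described in the context. Consider a set $V$ of $m=|V|>1$ agents and any demand type distribution and compatibilities $(\boldsymbol\phi,\mathcal P,\mathcal D)$, where $\mathcal P(j,\sigma)=\{j\}$, with $\alpha(\boldsymbol\phi,\mathcal P,\mathcal D)>0$. Let $K_1=P\big(m,1/\alpha(\boldsymbol\phi,\mathcal P,\mathcal D)\big)$. Then for the congestion function $f(\bar q)=-\sqrt m\,\bar q^{-1/2}$, any number of scrips $K\ge K_1$ and any horizon $T$, the MBP admission-and-provider-selection rule satisfies $$L_T^{\mathrm{MBP}}\le M_1\frac KT+M_2\frac1K\qquad\text{and}\qquad L^{\mathrm{MBP}}\le M_2\frac1K,\qquad M_1=Cm,\ M_2=Cm^2 .$$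
   Context: **Scrip-system model.** $V$ is a finite set of agents, $\Sigma$ a finite set of service types, and $\mathcal T\subseteq V\times\Sigma$ the set of demand types; a demand type $\tau=(j,\sigma)$ is a request by agent $j$ for service $\sigma$. For each $\tau=(j,\sigma)\in\mathcal T$ there is a nonempty set $\mathcal D(\tau)\subseteq V\setminus\{j\}$ of compatible providers, and $\mathcal P(\tau)=\{j\}$. Serving a demand of type $(j,\sigma)$ generates payoff $w_{j\sigma}\in\mathbb R$, normalized so that $\max|w_{j\sigma}|=1$. A fixed number $K$ of scrips is distributed among agents: the state at the start of period $t=1,2,\dots$ is $\mathbf q[t]\in\Omega_K=\{\mathbf q\in\mathbb Z_{\ge0}^V:\sum_iq_i=K\}$. In each period exactly one request arises, with type i.i.d. from $\boldsymbol\phi=(\phi_\tau)_{\tau\in\mathcal T}$. After observing the type $\tau=(j,\sigma)$ the planner either rejects (payoff $v[t]=0$, state unchanged) or, provided $q_j[t]>0$, selects a provider $k\in\mathcal D(\tau)$, in which case $v[t]=w_{j\sigma}$ and one scrip moves from $j$ to $k$. Feasible policies map the history to such (possibly randomized) decisions. **Connectedness.** $\alpha(\boldsymbol\phi,\mathcal P,\mathcal D)=\min_{\emptyset\ne S\subsetneq V}\sum_{\tau:\ \mathcal P(\tau)\cap S\ne\emptyset,\ \mathcal D(\tau)\cap(V\setminus S)\ne\emptyset}\phi_\tau$. **Performance.** $W_T^\pi=\min_{\mathbf q\in\Omega_K}\frac1T\sum_{t=1}^T\mathbb E[v^\pi[t]\mid\mathbf q[1]=\mathbf q]$, $W_T^*=\sup_\pi\max_{\mathbf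 q\in\Omega_K}\frac1T\sum_{t=1}^T\mathbb E[v^\pi[t]\mid\mathbf q[1]=\mathbf q]$ (sup over feasible policies, which may depend on $\boldsymbol\phi$), $L_T^\pi=W_T^*-W_T^\pi$; $W^\pi=\liminf_TW_T^\pi$, $W^*=\limsup_TW_T^*$, $L^\pi=W^*-W^\pi$. **MBP admission-and-provider-selection rule.** Normalized scrip balances: $\bar q_i=(q_i+\sqrt K)/\tilde K$, $\tilde K=K+m\sqrt K$. When a request of type $\tau=(j,\sigma)$ arises in period $t$: if $w_{j\sigma}+f(\bar q_j[t])-\min_{k\in\mathcal D(\tau)}f(\bar q_k[t])\ge0$ and $q_j[t]>0$, then agent $k^*\in\arg\min_{k\in\mathcal D(\tau)}f(\bar q_k[t])$ provides the service and receives one scrip from $j$; otherwise the request is rejected. *)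

(* Defs.v *)
From HB Require Import structures.
From mathcomp Require Import all_boot all_order all_algebra.
From mathcomp Require Import all_classical all_reals all_analysis.
Set Implicit Arguments.
Unset Strict Implicit.
Unset Printing Implicit Defensive.
Import Order.TTheory GRing.Theory Num.Theory.
Local Open Scope classical_set_scope.
Local Open Scope ring_scope.

(* Agents form the finite type V, service types the finite type Sigma; a pair
   (j, s) : V * Sigma is a request by agent j for service s.  The functions
   compat, phi and w matter only on demand; phi is extended by 0 outside it. *)
Record scrip_system (R : realType) (V Sigma : finType) := ScripSystem {
  demand : {set V * Sigma};
  compat : V * Sigma -> {set V};
  phi : V * Sigma -> R;
  w : V * Sigma -> R;
  compat_neq0 : forall tau, tau \in demand -> exists k, k \in compat tau;
  compat_irr : forall tau, tau \in demand -> tau.1 \notin compat tau;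
  phi_ge0 : forall tau, 0 <= phi tau;
  phi_out : forall tau, tau \notin demand -> phi tau = 0;
  phi_sum1 : \sum_(tau in demand) phi tau = 1;
  w_normalized : \big[Num.max/0]_(tau in demand) `|w tau| = 1
}.

Definition pickup {V Sigma : finType} (tau : V * Sigma) : {set V} :=
  [set tau.1]%SET.

Section Connectedness.
Context {R : realType} {V Sigma : finType}.

Definition cut (T : {set V * Sigma}) (ph : V * Sigma -> R)
    (P D : V * Sigma -> {set V}) (S : {set V}) : R :=
  \sum_(tau in T | (P tau :&: S != finset.set0)%SET &&
                   (D tau :&: ~: S != finset.set0)%SET) ph tau.

(* Here, as below for states and providers (but not for policies, where sup is
   a genuine supremum of values in [-1, 1]), inf and sup range over finite
   nonempty sets of reals (when 1 < #|V|), so they are the min and the max. *)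
Definition alpha (T : {set V * Sigma}) (ph : V * Sigma -> R)
    (P D : V * Sigma -> {set V}) : R :=
  inf [set cut T ph P D S | S in
        [set S : {set V} | S != finset.set0 /\ S != finset.setT]].

End Connectedness.

Section Dynamics.
Context {R : realType} {V Sigma : finType}.
Variable M : scrip_system R V Sigma.

Definition state := {ffun V -> nat}.

Definition Omega (K : nat) : set state :=
  [set q : state | (\sum_i q i)%N = K].

(* One period: the type of the request, and the decision, which is Some k if
   agent k is selected as provider and None if the request is rejected. *)
Definition event : finType := ((V * Sigma) * option V)%type.

Definition payoff (e : event) : R := if e.2 is Some _ then w M e.1 else 0.

(* Truncated subtraction is harmless: feasibility requires 0 < q e.1.1. *)
Definition next (q : state) (e : event) : state :=
  if e.2 is Some k then [ffun i => (q i - (i == e.1.1) + (i == k))%N] else q.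

Definition state_after (q1 : state) (h : seq event) : state := foldl next q1 h.

(* pi q1 h tau a is the probability of decision a on a request of type tau,
   given the initial state q1 and the events h of all earlier periods. *)
Definition policy := state -> seq event -> V * Sigma -> option V -> R.

Definition allowed (q : state) (tau : V * Sigma) (a : option V) : bool :=
  if a is Some k then (0 < q tau.1)%N && (k \in compat M tau) else true.

Definition feasible (pi : policy) : Prop :=
  forall q1 h tau, tau \in demand M ->
    [/\ forall a, 0 <= pi q1 h tau a,
        \sum_a pi q1 h tau a = 1
      & forall a, 0 < pi q1 h tau a -> allowed (state_after q1 h) tau a].

(* Probability, given q[1] = q1, that the first T periods are as in s. *)
Definition path_prob (pi : policy) (q1 : state) (T : nat)
    (s : T.-tuple event) : R :=
  \prod_(t < T) (phi M (tnth s t).1 *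
                 pi q1 (take t s) (tnth s t).1 (tnth s t).2).

Definition expected_payoff (pi : policy) (q1 : state) (T : nat) (t : 'I_T) : R :=
  \sum_(s : T.-tuple event) path_prob pi q1 s * payoff (tnth s t).

Definition average_payoff (pi : policy) (T : nat) (q1 : state) : R :=
  T%:R^-1 * \sum_(t < T) expected_payoff pi q1 t.

Definition W_T (K : nat) (pi : policy) (T : nat) : R :=
  inf [set average_payoff pi T q | q in Omega K].

Definition Wstar_T (K T : nat) : R :=
  sup [set sup [set average_payoff pi T q | q in Omega K] | pi in feasible].

Definition L_T (K : nat) (pi : policy) (T : nat) : R :=
  Wstar_T K T - W_T K pi T.

Definition W (K : nat) (pi : policy) : R := limn_inf (W_T K pi).

Definition Wstar (K : nat) : R := limn_sup (Wstar_T K).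

Definition L (K : nat) (pi : policy) : R := Wstar K - W K pi.

Definition normalized_balance (K : nat) (q : state) (i : V) : R :=
  ((q i)%:R + Num.sqrt K%:R) / (K%:R + #|V|%:R * Num.sqrt K%:R).

Definition MBP_admits (K : nat) (f : R -> R) (q : state) (tau : V * Sigma) : bool :=
  (0 <= w M tau + f (normalized_balance K q tau.1)
        - inf [set f (normalized_balance K q k) | k in [set` compat M tau]])
  && (0 < q tau.1)%N.

Definition MBP_decision (K : nat) (f : R -> R) (q : state) (tau : V * Sigma)
    (a : option V) : bool :=
  if a is Some k then
    [&& MBP_admits K f q tau, k \in compat M tau
      & [forall (k' | k' \in compat M tau),
           f (normalized_balance K q k) <= f (normalized_balance K q k')]]
  else ~~ MBP_admits K f q tau.

(* Ties in the argmin may be broken arbitrarily: at random, or depending on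
   the history. *)
Definition is_MBP (K : nat) (f : R -> R) (pi : policy) : Prop :=
  feasible pi /\
  forall q1 h tau a, tau \in demand M ->
    0 < pi q1 h tau a -> MBP_decision K f (state_after q1 h) tau a.

End Dynamics.

Definition congestion {R : realType} (m : nat) (x : R) : R :=
  - Num.sqrt m%:R * x `^ (- 2^-1).

(* Main.v *)
Require Import Defs.
From HB Require Import structures.
From mathcomp Require Import all_boot all_order all_algebra.
From mathcomp Require Import all_classical all_reals all_analysis.
From mathcomp Require Import ring lra zify.
Import Order.TTheory GRing.Theory Num.Theory.
Local Open Scope classical_set_scope.
Local Open Scope ring_scope.

(* For prices y on the agents, let dual y be the expected value of the largest
   of 0 and w + y j - y k over the compatible providers k.  Adding the drift of
   \sum_i y i * q i bounds the welfare of every policy by T * dual y plus K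
   times the spread of y, so by the infimum of dual over prices of spread at
   most 2 m.  MBP attains dual at its current prices f(qbar), up to the drift of
   the potential \sum_i \int f, a curvature term and the loss at empty queues.
   If the prices spread out further than 2 m, they have a gap of width 2, and
   closing it by 1 decreases dual by alpha; hence dual exceeds its infimum by
   alpha times the excess spread.  When the smallest balance is small this
   excess pays for the curvature and the empty queues, and otherwise the
   curvature is O(m ^ 2 / K). *)

(** * The dual function and its growth with the spread of prices *)

Section DualFunction.
Context {R : realType} {V Sigma : finType}.
Variable M : scrip_system R V Sigma.

Let al : R := alpha (demand M) (phi M) pickup (compat M).

Definition gain (y : V -> R) (tau : V * Sigma) : R :=
  \big[Num.max/0]_(k in compat M tau) (w M tau + y tau.1 - y k).

Definition dual (y : V -> R) : R :=
  \sum_(tau in demand M) phi M tau * gain y tau.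

(** By [dual_shift] the box stands for all prices of spread at most [2 * #|V|]. The bound is the
    total width of the [#|V|] intervals in [exists_gap]. *)
Definition dual_inf : R :=
  inf [set dual y | y in [set y : V -> R | forall i, 0 <= y i <= 2 * #|V|%:R]].

Lemma gain_ge0 y tau : 0 <= gain y tau.
Proof. exact: bigmax_ge_id. Qed.

Lemma gain_ge y tau k :
  k \in compat M tau -> w M tau + y tau.1 - y k <= gain y tau.
Proof. by move=> kD; apply: bigmax_sup kD _. Qed.

Lemma gain_le y tau b :
  0 <= b -> (forall k, k \in compat M tau -> w M tau + y tau.1 - y k <= b) ->
  gain y tau <= b.
Proof. by move=> b0 yb; apply: bigmax_le. Qed.

Lemma dual_ge0 y : 0 <= dual y.
Proof.
by apply: sumr_ge0 => tau _; rewrite mulr_ge0 ?gain_ge0 ?phi_ge0.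
Qed.

Lemma dual_shift y c : dual (fun i => y i - c) = dual y.
Proof.
apply: eq_bigr => tau _; congr (_ * _).
by apply: eq_bigr => k _; ring.
Qed.

Lemma dual_inf_le y : (forall i, 0 <= y i <= 2 * #|V|%:R) -> dual_inf <= dual y.
Proof.
move=> yb; apply: ge_inf; last by exists y.
by exists 0 => _ [z _ <-]; exact: dual_ge0.
Qed.

Lemma le_dual_inf b :
  (forall y, (forall i, 0 <= y i <= 2 * #|V|%:R) -> b <= dual y) ->
  b <= dual_inf.
Proof.
move=> bP; apply: lb_le_inf => [|_ [y yb <-]]; last exact: bP.
by exists (dual (fun=> 0)), (fun=> 0) => // i; rewrite lexx mulr_ge0.
Qed.

Lemma normr_w_le1 tau : tau \in demand M -> `|w M tau| <= 1.
Proof.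
by move=> tauD; rewrite -(w_normalized M); apply: bigmax_sup tauD _.
Qed.

Lemma alpha_le_cut (S : {set V}) : S != finset.set0 -> S != finset.setT ->
  al <= Defs.cut (demand M) (phi M) pickup (compat M) S.
Proof.
move=> S0 ST; apply: ge_inf; last by exists S.
by exists 0 => _ [z _ <-]; apply: sumr_ge0 => tau _; exact: phi_ge0.
Qed.

(* A request from above the gap with a compatible provider below it has gain at
   least 1, and loses 1 when the gap is closed by 1; no other gain increases. *)
Lemma dual_close_gap y (U : {set V}) :
  U != finset.set0 -> U != finset.setT ->
  (forall i k, i \in U -> k \notin U -> 2 <= y i - y k) ->
  dual (fun i => y i - (i \in U)%:R) + al <= dual y.
Proof.
move=> U0 UT gapU.
apply: (le_trans (lerD (lexx _) (alpha_le_cut U U0 UT))).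
rewrite /Defs.cut big_mkcondr -big_split /=; apply: ler_sum => tau tauD.
have /ler_normlP[wN1 w1] := normr_w_le1 _ tauD.
set y' := fun i => _.
have -> : (pickup tau :&: U != finset.set0)%SET = (tau.1 \in U).
  apply/set0Pn/idP => [[i]|tU]; first by rewrite !inE => /andP[/eqP ->].
  by exists tau.1; rewrite !inE eqxx tU.
case: ifP => [/andP[tU /set0Pn[k0]]|].
  rewrite !inE => /andP[k0D k0U].
  rewrite -{2}[phi M tau]mulr1 -mulrDr ler_wpM2l ?phi_ge0// -lerBrDr.
  have g0 := gapU _ _ tU k0U; have gk0 := gain_ge y _ _ k0D.
  apply: gain_le => [|k kD]; first by lra.
  have gk := gain_ge y _ _ kD.
  rewrite /y' tU; case: (boolP (k \in U)) => kU /=; last by lra.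
  by have := gapU _ _ kU k0U; lra.
move=> noU; rewrite addr0 ler_wpM2l ?phi_ge0//.
apply: gain_le => [|k kD]; first exact: gain_ge0.
have gk := gain_ge y _ _ kD; have g0 := gain_ge0 y tau.
rewrite /y'; case: (boolP (tau.1 \in U)) noU => tU /=.
  move/negbT; rewrite negbK => /eqP DU; have kU : k \in U.
    by apply: contraT => kU; move/setP/(_ k): DU; rewrite !inE kD kU.
  by move=> *; rewrite kU /=; lra.
move=> _; case: (boolP (k \in U)) => kU /=; last by lra.
by have := gapU _ _ kU tU; lra.
Qed.

(* Pigeonhole: the #|V| intervals ]lo + 2n, lo + 2n + 2] do not contain the
   agent at lo, so one of them is empty. *)
Lemma exists_gap (y : V -> R) (i0 : V) :
  exists2 n : nat, (n < #|V|)%N &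
    forall i, y i <= y i0 + 2 * n%:R \/ y i0 + 2 * n%:R + 2 < y i.
Proof.
apply: contrapT => nogap.
have hit (n : 'I_#|V|) :
    exists i, y i0 + 2 * n%:R < y i /\ y i <= y i0 + 2 * n%:R + 2.
  apply: contrapT => nohit; apply: nogap; exists n => // i.
  have [|lt_yi] := leP (y i) (y i0 + 2 * n%:R); first by left.
  by right; rewrite ltNge; apply/negP => ?; apply: nohit; exists i.
have [h hP] := choice hit.
have h_inj : injective h.
  move=> a b hab; apply/val_inj/eqP => /=.
  have [ha1 ha2] := hP a; have := hP b; rewrite -hab => -[hb1 hb2].
  have : (a%:R : R) < b%:R + 1 by lra.
  have : (b%:R : R) < a%:R + 1 by lra.
  by rewrite !natr1 !ltr_nat !ltnS eqn_leq => -> ->.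
have /codomP[n ni0] := inj_card_onto h_inj (eq_leq (esym (card_ord _))) i0.
by have [] := hP n; rewrite -ni0; have : (0 <= n%:R :> R) by []; lra.
Qed.

(** Induction on [n], which bounds the excess spread. As long as the spread exceeds [2 * #|V|] there
    is a gap, and closing it by 1 lowers the spread by 1 and [dual] by at least [al]. The gap has
    width 2, so [i0] and [i1] remain the extreme agents. *)
Lemma dual_ge_spread_bounded (n : nat) (y : V -> R) (i0 i1 : V) :
  0 <= al -> (forall i, y i0 <= y i <= y i1) ->
  y i1 - y i0 <= 2 * #|V|%:R + n%:R ->
  dual_inf + al * (y i1 - y i0 - 2 * #|V|%:R) <= dual y.
Proof.
(* Without excess spread the factor of [al] is nonpositive, and shifting the minimum to 0 puts the
   prices into the box of [dual_inf]. *)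
move=> al0; have small z : (forall i, z i0 <= z i <= z i1) ->
    z i1 - z i0 <= 2 * #|V|%:R ->
    dual_inf + al * (z i1 - z i0 - 2 * #|V|%:R) <= dual z.
  move=> zb zs; rewrite -(dual_shift z (z i0)).
  apply: le_trans (dual_inf_le _ _).
    by rewrite gerDl mulr_ge0_le0// subr_le0.
  by move=> i; have /andP[? ?] := zb i; apply/andP; split; lra.
elim: n y => [|n IHn] y yb ys; first by apply: small; rewrite ?addr0 in ys.
have [|large] := leP (y i1 - y i0) (2 * #|V|%:R); first exact: small.
have [l lV gap] := exists_gap y i0.
(* The gap ends at most [2 * #|V|] above the minimum, hence below [y i1]; so the set [U] of agents
   above it is nonempty and proper. *)
have {}lV : (l%:R + 1 <= #|V|%:R :> R) by rewrite natr1 ler_nat.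
have l0 : (0 <= l%:R :> R) by [].
pose U := [set i | y i0 + 2 * l%:R + 2 < y i]%SET.
have i1U : i1 \in U by rewrite inE; have [] := gap i1; lra.
have i0U : i0 \notin U by rewrite inE -leNgt; lra.
have U0 : U != finset.set0 by apply/set0Pn; exists i1.
have UT : U != finset.setT by apply: contraNneq i0U => ->; rewrite inE.
have gapU i k : i \in U -> k \notin U -> 2 <= y i - y k.
  by rewrite !inE -leNgt => ? ?; have [] := gap k; lra.
have gapn i : i \notin U -> y i <= y i0 + 2 * l%:R.
  by rewrite inE -leNgt => ?; have [] := gap i; lra.
apply: le_trans (dual_close_gap y U U0 UT gapU).
have : dual_inf + al * (y i1 - 1 - y i0 - 2 * #|V|%:R) <=
    dual (fun i => y i - (i \in U)%:R).
  have := IHn (fun i => y i - (i \in U)%:R).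
  rewrite i1U (negbTE i0U) subr0 /=; apply; last by rewrite -natr1 in ys; lra.
  move=> i; have /andP[? ?] := yb i; case: (boolP (i \in U)) => iU /=.
    by move: iU; rewrite inE => iU; apply/andP; split; lra.
  by have := gapn _ iU; move: i1U; rewrite inE => ? ?; apply/andP; split; lra.
by lra.
Qed.

Lemma dual_ge_spread (y : V -> R) (i0 i1 : V) :
  0 <= al -> (forall i, y i0 <= y i <= y i1) ->
  dual_inf + al * (y i1 - y i0 - 2 * #|V|%:R) <= dual y.
Proof.
move=> al0 yb.
have y10 : 0 <= y i1 - y i0 by rewrite subr_ge0; have /andP[] := yb i1.
apply: (dual_ge_spread_bounded (Num.trunc (y i1 - y i0)).+1) => //.
have /andP[_ /ltW] := trunc_itv y10.
by have : 0 <= (#|V|%:R : R) by []; lra.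
Qed.

(** Makes [dual_inf] the infimum over all prices, so that it can be compared with [dual] at the MBP
    prices, which need not lie in a box of width [2 * #|V|]. *)
Lemma dual_inf_le_dual (y : V -> R) : 0 <= al -> (0 < #|V|)%N ->
  dual_inf <= dual y.
Proof.
move=> al0 /card_gt0P[v _].
have [i0 _ i0P] := @arg_minP _ _ _ v xpredT y erefl.
have [i1 _ i1P] := @arg_maxP _ _ _ v xpredT y erefl.
have yb i : y i0 <= y i <= y i1 by rewrite i0P //; exact: i1P.
have [small|large] := leP (y i1 - y i0) (2 * #|V|%:R).
  rewrite -(dual_shift y (y i0)); apply: dual_inf_le => i.
  by have /andP[? ?] := yb i; apply/andP; split; lra.
apply: le_trans (dual_ge_spread y i0 i1 al0 yb).
by rewrite lerDl mulr_ge0// subr_ge0 ltW.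
Qed.

End DualFunction.

(** * Expectations over histories and the drift inequality *)

Lemma rcons_tuple_bij (E : finType) (T : nat) :
  bijective (fun p : T.-tuple E * E => [tuple of rcons p.1 p.2]).
Proof.
apply/inj_card_bij; last by rewrite card_prod !card_tuple expnSr.
by move=> [s e] [s' e'] /(congr1 val)/= /rcons_inj[/val_inj -> ->].
Qed.

Lemma big_tuple_rcons (R : realType) (E : finType) (T : nat)
    (F : T.+1.-tuple E -> R) :
  \sum_(s : T.+1.-tuple E) F s =
  \sum_(s : T.-tuple E) \sum_(e : E) F [tuple of rcons s e].
Proof.
by rewrite pair_big /= (reindex _ (onW_bij _ (rcons_tuple_bij E T))).
Qed.

Section Telescoping.
Context {R : realType} {V Sigma : finType}.
Variables (M : scrip_system R V Sigma) (pi : policy (R := R) (V := V) (Sigma := Sigma)).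
Local Notation St := (state (V := V)).
Local Notation Ev := (event (V := V) (Sigma := Sigma)).
Hypothesis pi_feasible : feasible M pi.

Definition event_prob (q1 : St) (h : seq Ev)
    (e : Ev) : R :=
  phi M e.1 * pi q1 h e.1 e.2.

Definition history_mean (q1 : St) (T : nat)
    (G : seq Ev -> R) : R :=
  \sum_(s : T.-tuple Ev) path_prob M pi q1 s * G s.

Lemma path_prob_rcons q1 T (s : T.-tuple Ev) e :
  path_prob M pi q1 [tuple of rcons s e] = path_prob M pi q1 s * event_prob q1 s e.
Proof.
rewrite /path_prob big_ord_recr /=; congr (_ * _).
  apply: eq_bigr => t _; rewrite !(tnth_nth e) /= nth_rcons size_tuple ltn_ord.
  by rewrite -cats1 takel_cat// size_tuple ltnW.
rewrite (tnth_nth e) /= nth_rcons size_tuple ltnn eqxx.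
by rewrite -cats1 takel_cat ?size_tuple// take_oversize ?size_tuple.
Qed.

Lemma history_meanD q1 T G H :
  history_mean q1 T G + history_mean q1 T H = history_mean q1 T (fun h => G h + H h).
Proof. by rewrite -big_split; apply: eq_bigr => s _; rewrite mulrDr. Qed.

Lemma history_mean_rcons q1 T G :
  history_mean q1 T.+1 G =
  history_mean q1 T (fun h => \sum_e event_prob q1 h e * G (rcons h e)).
Proof.
rewrite /history_mean big_tuple_rcons; apply: eq_bigr => s _.
by rewrite mulr_sumr; apply: eq_bigr => e _; rewrite path_prob_rcons mulrA.
Qed.

Lemma event_prob_ge0 q1 h e : 0 <= event_prob q1 h e.
Proof.
rewrite /event_prob; have [eD|eD] := boolP (e.1 \in demand M).
  by have [p0 _ _] := pi_feasible q1 h _ eD; rewrite mulr_ge0 ?phi_ge0.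
by rewrite phi_out// mul0r.
Qed.

(** Summing out the decision leaves the law of the type. Outside [demand] feasibility says nothing
    about [pi], but there [phi] vanishes. *)
Lemma sum_event_prob q1 h (F : V * Sigma -> R) :
  \sum_e event_prob q1 h e * F e.1 = \sum_(tau in demand M) phi M tau * F tau.
Proof.
rewrite -(pair_bigA _ (fun tau a => event_prob q1 h (tau, a) * F tau)) /=.
rewrite [RHS]big_mkcond /=; apply: eq_bigr => tau _; case: ifP => tauD.
  have [_ p1 _] := pi_feasible q1 h _ tauD.
  rewrite -[RHS]mul1r -p1 mulr_suml; apply: eq_bigr => a _.
  by rewrite /event_prob /=; ring.
by rewrite big1// => a _; rewrite /event_prob phi_out ?tauD//= !mul0r.
Qed.

Lemma event_prob_gt0 q1 h e : event_prob q1 h e != 0 ->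
  e.1 \in demand M /\ 0 < pi q1 h e.1 e.2.
Proof.
rewrite /event_prob mulf_eq0 negb_or => /andP[phi0 pi0].
have eD : e.1 \in demand M by apply: contraNT phi0 => /phi_out ->.
by split=> //; have [p0 _ _] := pi_feasible q1 h _ eD; rewrite lt_def pi0 p0.
Qed.

Lemma path_prob_ge0 q1 T (s : T.-tuple Ev) :
  0 <= path_prob M pi q1 s.
Proof. by apply: prodr_ge0 => t _; exact: event_prob_ge0. Qed.

Lemma history_mean0 q1 G : history_mean q1 0 G = G [::].
Proof.
rewrite /history_mean (big_pred1 [tuple]) => [|s].
  by rewrite /path_prob big_ord0 mul1r.
by apply/esym/eqP; exact: tuple0.
Qed.

Lemma history_mean_cst q1 T c : history_mean q1 T (fun=> c) = c.
Proof.
elim: T c => [|T IHT] c.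
  exact: history_mean0.
rewrite history_mean_rcons -[RHS]IHT; apply: eq_bigr => s _; congr (_ * _).
rewrite (sum_event_prob q1 s (fun=> c)) -mulr_suml phi_sum1 mul1r.
by [].
Qed.

Lemma next_Omega K (q : St) tau a :
  allowed M q tau a -> Omega K q -> Omega K (Defs.next q (tau, a)).
Proof.
case: a => [k|] //= /andP[q0 _] <-; rewrite /Omega /Defs.next /=.
have sum_eq1 (j : V) : (\sum_i (i == j) = 1)%N.
  by rewrite (bigD1 j)//= eqxx big1// => i /negbTE ->.
(* Adding the indicator of the requester to both sides cancels the truncated subtraction, as
   [q tau.1] is positive. *)
apply: (@addIn (\sum_i (i == tau.1))%N); rewrite {2}sum_eq1 -[in RHS](sum_eq1 k).
rewrite -!big_split /=; apply: eq_bigr => i _.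
by rewrite ffunE; case: eqP => [->|_]; lia.
Qed.

Lemma path_prob_Omega K q1 T (s : T.-tuple Ev) : Omega K q1 ->
  path_prob M pi q1 s != 0 -> Omega K (state_after q1 s).
Proof.
move=> q1K; elim: T s => [|T IHT] s; first by rewrite tuple0.
have [g _ gK] := rcons_tuple_bij Ev T; rewrite -(gK s); case: (g s) => {}s [tau a].
rewrite path_prob_rcons mulf_eq0 negb_or => /andP[/IHT sK /event_prob_gt0[/= tD pi0]].
rewrite /= /state_after foldl_rcons; apply: next_Omega => //.
by have [_ _ ->] := pi_feasible q1 s _ tD.
Qed.

Lemma ler_history_mean K q1 T G H : Omega K q1 ->
  (forall h, Omega K (state_after q1 h) -> G h <= H h) ->
  history_mean q1 T G <= history_mean q1 T H.
Proof.
move=> q1K GH; apply: ler_sum => s _.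
have [->|s0] := eqVneq (path_prob M pi q1 s) 0; first by rewrite !mul0r.
by rewrite ler_wpM2l ?path_prob_ge0// GH//; exact: path_prob_Omega s0.
Qed.

Lemma history_mean_payoff (r : Ev -> R) q1 T :
  history_mean q1 T (fun h => \sum_(e <- h) r e) =
  \sum_(t < T) \sum_(s : T.-tuple Ev) path_prob M pi q1 s * r (tnth s t).
Proof.
rewrite exchange_big; apply: eq_bigr => s _ /=.
by rewrite big_tuple mulr_sumr.
Qed.

(** Lyapunov argument: the accumulated reward minus the increase of [Phi] grows by at most [c] per
    period in expectation, and the increments of [Phi] telescope to a term bounded by [b]. It yields
    both the upper bound for all policies and, with signs reversed, the lower bound for MBP. *)
Lemma history_mean_drift K (r : Ev -> R) (Phi : St -> R) (c b : R) q1 T :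
  Omega K q1 ->
  (forall h, let q := state_after q1 h in Omega K q ->
     \sum_e event_prob q1 h e * (r e - (Phi (Defs.next q e) - Phi q)) <= c) ->
  (forall q q', Omega K q -> Omega K q' -> Phi q - Phi q' <= b) ->
  history_mean q1 T (fun h => \sum_(e <- h) r e) <= T%:R * c + b.
Proof.
move=> q1K drift Phib.
pose G h := \sum_(e <- h) r e - (Phi (state_after q1 h) - Phi q1).
have GT : history_mean q1 T G <= T%:R * c.
  elim: T => [|T IHT].
    by rewrite history_mean0 /G /= big_nil !subrr mul0r.
  rewrite -natr1 mulrDl mul1r history_mean_rcons.
  have -> : T%:R * c + c = T%:R * c + history_mean q1 T (fun=> c).
    by rewrite history_mean_cst.
  apply: le_trans (lerD IHT (lexx _)); rewrite history_meanD.
  apply: (ler_history_mean K) => // h hK; rewrite -lerBlDl.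
  apply: le_trans (drift h hK).
  have -> : G h = \sum_e event_prob q1 h e * G h.
    by rewrite (sum_event_prob q1 h (fun=> G h)) -mulr_suml phi_sum1 mul1r.
  rewrite -sumrB; apply: ler_sum => e _.
  rewrite -mulrBr /G /state_after foldl_rcons big_rcons /=.
  rewrite ler_wpM2l ?event_prob_ge0//; lra.
apply: le_trans (lerD GT (lexx b)); rewrite -[in leRHS](history_mean_cst q1 T b).
rewrite history_meanD; apply: (ler_history_mean K) => // h hK; rewrite /G.
by have := Phib _ _ hK q1K; lra.
Qed.

End Telescoping.

(** * Upper bound on the welfare of every feasible policy *)

Section WelfareBounds.
Context {R : realType} {V Sigma : finType}.
Variable M : scrip_system R V Sigma.
Local Notation St := (state (V := V)).

Lemma average_payoffE pi T (q1 : St) :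
  average_payoff M pi T q1 =
  T%:R^-1 * history_mean M pi q1 T (fun h => \sum_(e <- h) payoff M e).
Proof. by rewrite history_mean_payoff. Qed.

Lemma sum_next (G : V -> nat -> R) (q : St) (tau : V * Sigma) k : tau.1 != k ->
  \sum_i G i (Defs.next q (tau, Some k) i) - \sum_i G i (q i) =
  (G tau.1 (q tau.1).-1 - G tau.1 (q tau.1)) + (G k (q k).+1 - G k (q k)).
Proof.
move=> jk; rewrite -sumrB (bigD1 tau.1)//= (bigD1 k) 1?eq_sym//= big1 => [|i].
  rewrite !ffunE !eqxx (negbTE jk) eq_sym (negbTE jk).
  by rewrite subn1 addn0 subn0 addn1 addr0.
by case/andP=> /negbTE ij /negbTE ik; rewrite ffunE ij ik subn0 addn0 subrr.
Qed.

(** For fixed [y] in the box, a served request changes [\sum_i y i * q i] by the provider's price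
    minus the requester's, so payoff minus drift is at most [gain]. The potential ranges over an
    interval of length [2 * #|V| * K], and [y] is arbitrary. *)
Lemma average_payoff_le pi K T (q1 : St) :
  feasible M pi -> Omega K q1 -> (0 < T)%N ->
  average_payoff M pi T q1 <= dual_inf M + 2 * #|V|%:R * (K%:R / T%:R).
Proof.
move=> piF q1K T0; have T0' : 0 < T%:R :> R by rewrite ltr0n.
rewrite -lerBlDr; apply: le_dual_inf => y yb.
rewrite lerBlDr average_payoffE ler_pdivrMl// mulrDr.
have -> : T%:R * (2 * #|V|%:R * (K%:R / T%:R)) = 2 * #|V|%:R * K%:R :> R.
  by field; rewrite gt_eqF.
pose Phi (q : St) := \sum_i y i * (q i)%:R.
have PhiK q : Omega K q -> 0 <= Phi q <= 2 * #|V|%:R * K%:R.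
  move=> <-; rewrite natr_sum mulr_sumr; apply/andP; split.
    by apply: sumr_ge0 => i _; have /andP[? _] := yb i; rewrite mulr_ge0.
  by apply: ler_sum => i _; have /andP[_ ?] := yb i; rewrite ler_wpM2r.
apply: (history_mean_drift M pi piF K (payoff M) Phi) => // [h q qK|q q'].
  rewrite /dual -(sum_event_prob M pi piF q1 h); apply: ler_sum => e _.
  have [->|/(event_prob_gt0 M pi piF)[eD pi0]] := eqVneq (event_prob M pi q1 h e) 0.
    by rewrite !mul0r.
  rewrite ler_wpM2l ?event_prob_ge0//.
  have [_ _ /(_ _ pi0)] := piF q1 h _ eD; case: e eD pi0 => tau [k|] /= tD _.
    case/andP=> q0 kD; rewrite /Phi (sum_next (fun i n => y i * n%:R)); last first.
      by apply: contraNneq (compat_irr tD) => ->.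
    rewrite -natr1 -[in X in _ - (_ - X + _)](prednK q0) -natr1 /payoff /=.
    by have := gain_ge M y _ _ kD; lra.
  by move=> _; rewrite /payoff /= subrr subr0 gain_ge0.
by move=> /PhiK/andP[_ ?] /PhiK/andP[? _]; lra.
Qed.

End WelfareBounds.

(** * Elementary inequalities for the curvature and the error terms *)

(** Second-order expansion of the square root at [s ^+ 2]. The coefficient 1/2 in place of Taylor's
    1/8 makes it valid down to [u = 0], where equality holds; the difference of the sides factors
    explicitly. *)
Lemma sqrt_tangent_le (R : realFieldType) (s u : R) : 0 < s -> 0 <= u ->
  s + (u ^+ 2 - s ^+ 2) / (2 * s) - (u ^+ 2 - s ^+ 2) ^+ 2 / (2 * s ^+ 3) <= u.
Proof.
move=> s0 u0; rewrite -subr_ge0.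
have -> : u - (s + (u ^+ 2 - s ^+ 2) / (2 * s)
    - (u ^+ 2 - s ^+ 2) ^+ 2 / (2 * s ^+ 3)) =
    (u - s) ^+ 2 * (u ^+ 2 + 2 * u * s) / (2 * s ^+ 3).
  by field; rewrite gt_eqF.
have u0' : 0 <= u ^+ 2 + 2 * u * s by rewrite addr_ge0 ?sqr_ge0 ?mulr_ge0 ?(ltW s0).
have s0' : 0 <= 2 * s ^+ 3 by rewrite mulr_ge0 ?exprn_ge0 ?(ltW s0).
by rewrite divr_ge0// mulr_ge0// sqr_ge0.
Qed.

(* The two regimes of the least loaded agent, whose inverse square root balance
   is [rho]: if it is at most [6 * sqrt m], then the curvature term is
   O(m ^ 2 / K); otherwise the gain [al * (sm * rho - 3 * m)] from closing the
   gaps dominates both the curvature and the empty queue. *)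
Lemma error_tradeoff (R : realFieldType) (m sm sK al rho d : R) (empty : bool) :
  1 <= sm -> sm ^+ 2 = m -> 0 < sK -> 0 < al -> 0 < rho -> 0 <= d ->
  1297 * m ^+ 2 <= sK ^+ 2 -> 8 <= al * sK -> 16 <= al ^+ 2 * sK ->
  al * (sm * rho - 3 * m) <= d ->
  rho ^+ 2 * sK <= sK ^+ 2 + m * sK ->
  (empty -> rho ^+ 2 * sK = sK ^+ 2 + m * sK) ->
  2 * sm * rho ^+ 3 / (sK ^+ 2 + m * sK) + empty%:R <=
  d + 432 * m ^+ 2 / sK ^+ 2.
Proof.
move=> sm1 smE sK0 al0 rho0 d0 K1 K2 K3 dP rhoK rhoE.
have m0 : 0 < m by rewrite -smE exprn_gt0// (lt_le_trans ltr01).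
have Kt0 : 0 < sK ^+ 2 + m * sK by rewrite addr_gt0 ?exprn_gt0 ?mulr_gt0.
have rhoE' : empty -> sK <= rho ^+ 2.
  move=> /rhoE rE; rewrite -(ler_pM2r sK0) rE -expr2 lerDl.
  by rewrite mulr_ge0 ?ltW//.
have sm0 : 0 < sm by exact: lt_le_trans ltr01 sm1.
have [small|large] := leP rho (6 * sm).
  (* An empty queue would force [sK <= rho ^+ 2 <= 36 * m], against [1297 * m ^+ 2 <= sK ^+ 2],
     since 1297 exceeds the square of 36. *)
  have -> : empty = false.
    apply/negbTE/negP => /rhoE' sKr.
    have r2 : rho ^+ 2 <= 36 * m.
      have -> : 36 * m = (6 * sm) ^+ 2 by rewrite -smE; ring.
      by rewrite ler_sqr ?nnegrE ?mulr_ge0 ?(ltW sm0) ?(ltW rho0).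
    have : sK ^+ 2 <= (36 * m) ^+ 2.
      by rewrite ler_sqr ?nnegrE ?mulr_ge0 ?(ltW m0) ?(ltW sK0)// (le_trans sKr).
    have := exprn_gt0 2 m0; lra.
  rewrite addr0; apply: le_trans (_ : 432 * m ^+ 2 / sK ^+ 2 <= _); last first.
    by rewrite lerDr.
  apply: ler_pM; rewrite ?mulr_ge0 ?invr_ge0 ?exprn_ge0
    ?(ltW Kt0) ?(ltW sm0) ?(ltW rho0)//.
    have r3 : rho ^+ 3 <= (6 * sm) ^+ 3.
      by rewrite lerXn2r ?nnegrE ?mulr_ge0 ?(ltW sm0) ?(ltW rho0).
    have -> : 432 * m ^+ 2 = 2 * sm * (6 * sm) ^+ 3 by rewrite -smE; ring.
    by rewrite ler_wpM2l ?mulr_ge0 ?(ltW sm0).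
  by rewrite lef_pV2 ?posrE ?exprn_gt0// lerDl mulr_ge0 ?ltW//.
(* As [rho > 6 * sm], the excess [sm * rho - 3 * m] is at least half of [sm * rho]. Curvature (by
   [8 <= al * sK]) and empty queue (by [16 <= al ^+ 2 * sK]) use a quarter each. *)
have E1 : 2 * sm * rho ^+ 3 / (sK ^+ 2 + m * sK) <= al * (sm * rho) / 4.
  rewrite ler_pdivrMr//.
  have -> : 2 * sm * rho ^+ 3 = 2 * sm * rho * rho ^+ 2 by ring.
  have h1 : 8 * rho ^+ 2 <= al * (sK ^+ 2 + m * sK).
    apply: le_trans (_ : al * (rho ^+ 2 * sK) <= _); last by rewrite ler_pM2l.
    by have := ler_wpM2r (sqr_ge0 rho) K2; lra.
  have := ler_wpM2l (ltW (mulr_gt0 sm0 rho0)) h1; lra.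
have E2 : empty%:R <= al * (sm * rho) / 4.
  case: empty rhoE' {rhoE} => [/(_ isT) sKr|_]; last first.
    by rewrite !mulr_ge0 ?invr_ge0 ?ltW//.
  rewrite ler_pdivlMr// mul1r.
  have h4 : 4 <= al * rho.
    rewrite -(@ler_sqr _ 4) ?nnegrE ?mulr_ge0 ?(ltW al0) ?(ltW rho0)// exprMn.
    have := ler_wpM2l (sqr_ge0 al) sKr; lra.
  have := ler_wpM2l (ltW (mulr_gt0 al0 rho0)) sm1; lra.
have E3 : al * (sm * rho) / 2 <= d.
  apply: le_trans dP; rewrite -mulrA ler_pM2l//.
  have := ler_wpM2l (ltW sm0) (ltW large); rewrite -smE; lra.
have : 0 <= 432 * m ^+ 2 / sK ^+ 2.
  apply: divr_ge0; last exact/exprn_ge0/ltW.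
  by apply: mulr_ge0; [exact: ler0n|exact/exprn_ge0/ltW].
lra.
Qed.

(** This is [sqrt_tangent_le] scaled by [2 * Kt * sm]; [d] is 1 for the agent receiving the scrip
    and -1 for the one paying it. *)
Lemma sqrt_potential_step (R : realFieldType) (Kt sm s u d : R) :
  0 < Kt -> 0 <= sm -> 0 < s -> 0 <= u ->
  u ^+ 2 = s ^+ 2 + d / Kt -> d ^+ 2 = 1 ->
  d * sm * s^-1 - sm * s^-1 ^+ 3 / Kt <= 2 * Kt * sm * (u - s).
Proof.
move=> Kt0 sm0 s0 u0 uE d1.
have -> : d * sm * s^-1 - sm * s^-1 ^+ 3 / Kt =
    2 * Kt * sm * (s + (u ^+ 2 - s ^+ 2) / (2 * s)
      - (u ^+ 2 - s ^+ 2) ^+ 2 / (2 * s ^+ 3) - s).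
  rewrite uE [s ^+ 2 + _]addrC addrK expr_div_n d1.
  by field; rewrite !gt_eqF.
by rewrite ler_wpM2l ?mulr_ge0 ?(ltW Kt0)// lerD2r sqrt_tangent_le.
Qed.

(** * Drift of the potential under MBP and the lower bound on its welfare *)

Section MBPDrift.
Context {R : realType} {V Sigma : finType}.
Variables (M : scrip_system R V Sigma) (K : nat).
Hypothesis K_gt0 : (0 < K)%N.
Local Notation St := (state (V := V)).

Let m : R := #|V|%:R.
Let sm : R := Num.sqrt m.
Let sK : R := Num.sqrt K%:R.
Let Kt : R := K%:R + m * sK.

Definition root_balance (q : St) (i : V) : R :=
  Num.sqrt (normalized_balance K q i).

Definition price (q : St) (i : V) : R :=
  congestion #|V| (normalized_balance K q i).

Definition potential_term (n : nat) : R :=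
  - (2 * Kt * sm * Num.sqrt ((n%:R + sK) / Kt)).

(* [Kt] times the sum of the antiderivatives of the congestion function at the
   normalized balances. *)
Definition potential (q : St) : R := \sum_i potential_term (q i).

Let sK_gt0 : 0 < sK. Proof. by rewrite sqrtr_gt0 ltr0n. Qed.

Let m_ge0 : 0 <= m. Proof. exact: ler0n. Qed.

Let sm_ge0 : 0 <= sm. Proof. exact: sqrtr_ge0. Qed.

Let sqr_sm : sm ^+ 2 = m. Proof. by rewrite sqr_sqrtr. Qed.

Let sqr_sK : sK ^+ 2 = K%:R. Proof. by rewrite sqr_sqrtr. Qed.

Let Kt_gt0 : 0 < Kt.
Proof. by rewrite ltr_pwDl ?ltr0n// mulr_ge0// ltW. Qed.

Lemma normalized_balance_gt0 (q : St) i : 0 < normalized_balance K q i :> R.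
Proof. by rewrite divr_gt0// ltr_wpDl. Qed.

Lemma root_balance_gt0 q i : 0 < root_balance q i.
Proof. by rewrite sqrtr_gt0 normalized_balance_gt0. Qed.

Lemma sqr_root_balance q i : root_balance q i ^+ 2 = ((q i)%:R + sK) / Kt.
Proof. by rewrite sqr_sqrtr// ltW// normalized_balance_gt0. Qed.

Lemma priceE q i : price q i = - (sm * (root_balance q i)^-1).
Proof.
rewrite /price /congestion powRN powR12_sqrt ?mulNr//.
exact/ltW/normalized_balance_gt0.
Qed.

Lemma inv_root_balance_le (q : St) i k : (q i <= q k)%N ->
  (root_balance q k)^-1 <= (root_balance q i)^-1.
Proof.
move=> qik; rewrite lef_pV2 ?posrE ?root_balance_gt0// ler_wsqrtr//.
by rewrite ler_wpM2r ?invr_ge0 ?(ltW Kt_gt0)// lerD2r ler_nat.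
Qed.

Lemma price_le (q : St) i k : (q i <= q k)%N -> price q i <= price q k.
Proof.
by move=> qik; rewrite !priceE lerN2 ler_wpM2l// inv_root_balance_le.
Qed.

Lemma sum_normalized_balance (q : St) : Omega K q ->
  \sum_i normalized_balance K q i = 1 :> R.
Proof.
move=> qK; rewrite -mulr_suml big_split /= -natr_sum qK sumr_const.
by rewrite -[Num.sqrt _ *+ _]mulr_natl divff// (gt_eqF Kt_gt0).
Qed.

(** Apply [2 * a <= a ^+ 2 + 1] with [a] equal to [sm] times the root balance: since the normalized
    balances sum to 1, the total is at most [m + m]. *)
Lemma potential_bounds (q : St) : Omega K q ->
  - (2 * Kt * m) <= potential q <= 0.
Proof.
move=> qK; apply/andP; split; last first.
  apply: sumr_le0 => i _.
  by rewrite oppr_le0 !mulr_ge0 ?sqrtr_ge0 ?(ltW Kt_gt0).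
rewrite /potential sumrN lerN2.
apply: le_trans (_ : \sum_i Kt * (m * normalized_balance K q i + 1) <= _).
  apply: ler_sum => i _; set x := normalized_balance K q i.
  rewrite -[_ / Kt]/x.
  have xE : Num.sqrt x ^+ 2 = x by rewrite sqr_sqrtr// ltW// normalized_balance_gt0.
  have -> : 2 * Kt * sm * Num.sqrt x = Kt * (2 * sm * Num.sqrt x) by ring.
  rewrite ler_pM2l// -{2}xE -sqr_sm.
  by have := sqr_ge0 (sm * Num.sqrt x - 1); lra.
rewrite -mulr_sumr big_split /= -mulr_sumr sum_normalized_balance//.
by rewrite sumr_const -/m; lra.
Qed.

Lemma potential_term_step (q : St) i n (d : R) :
  n%:R = (q i)%:R + d -> d ^+ 2 = 1 ->
  d * sm * (root_balance q i)^-1 - sm * (root_balance q i)^-1 ^+ 3 / Kt <=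
  potential_term (q i) - potential_term n.
Proof.
move=> nE d1; rewrite /potential_term opprK [leRHS]addrC -mulrBr.
apply: sqrt_potential_step => //; first exact: root_balance_gt0.
rewrite sqr_root_balance sqr_sqrtr; first by rewrite nE; ring.
by rewrite divr_ge0 ?(ltW Kt_gt0)// addr_ge0// ltW.
Qed.

(** MBP takes a cheapest provider and serves when the priced payoff is nonnegative, so it attains
    [gain] unless the requester has no scrip. The curvature errors of the two changed terms are each
    at most half of the first error, because [i0] has the least balance. *)
Lemma mbp_step (q : St) i0 tau a : (forall i, (q i0 <= q i)%N) ->
  tau \in demand M -> MBP_decision M K (congestion #|V|) q tau a ->
  gain M (price q) tau -
    (2 * sm * (root_balance q i0)^-1 ^+ 3 / Kt + (q i0 == 0%N)%:R) <=
  payoff M (tau, a) - (potential (Defs.next q (tau, a)) - potential q).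
Proof.
move=> q0P tD; have := normr_w_le1 M _ tD; rewrite ler_norml => /andP[wN1 w1].
have rho_ge0 i : 0 <= (root_balance q i)^-1 by rewrite invr_ge0 ltW// root_balance_gt0.
set E : R := _ / Kt; have E_ge0 : 0 <= E.
  by rewrite /E divr_ge0 ?mulr_ge0 ?exprn_ge0 ?(ltW Kt_gt0).
have e_ge0 : 0 <= (q i0 == 0%N)%:R :> R by [].
case: a => [k /and3P[/andP[adm qj0] kD kP]|]; rewrite /payoff /=.
  have {}kP k' : k' \in compat M tau -> price q k <= price q k'.
    by move=> k'D; move/forallP/(_ k'): kP; rewrite k'D.
  have jk : tau.1 != k by apply: contraNneq (compat_irr tD) => ->.
  rewrite /potential (sum_next (fun=> potential_term))//.
  have infk : price q k <= inf [set price q k' | k' in [set` compat M tau]].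
    by apply: lb_le_inf => [|_ [k' k'D <-]]; [exists (price q k), k|exact: kP].
  have gk : gain M (price q) tau <= w M tau + price q tau.1 - price q k.
    apply: gain_le => [|k' /kP]; last by lra.
    by move: adm; rewrite -/(price _ _) => adm; lra.
  have cube i : 2 * (sm * (root_balance q i)^-1 ^+ 3 / Kt) <= E.
    have -> : E = 2 * (sm * (root_balance q i0)^-1 ^+ 3 / Kt) by rewrite /E; ring.
    rewrite ler_pM2l// ler_wpM2r ?invr_ge0 ?(ltW Kt_gt0)// ler_wpM2l//.
    by rewrite lerXn2r ?nnegrE// inv_root_balance_le.
  have sj := @potential_term_step q tau.1 (q tau.1).-1 (-1).
  have sk := @potential_term_step q k (q k).+1 1.
  have := sj ltac:(by rewrite -[in RHS](prednK qj0) -natr1 addrK)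
    ltac:(by rewrite sqrrN expr1n).
  have := sk ltac:(by rewrite natr1) (expr1n _ _).
  have := cube tau.1; have := cube k; move: gk; rewrite !priceE; lra.
rewrite subrr subr0 subr_le0.
rewrite /MBP_admits -/(price _ _) negb_and -ltNge -leqNgt leqn0.
case: (eqVneq (q tau.1) 0%N) => [qj0 _|qj0].
  have -> : q i0 = 0%N by apply/eqP; rewrite -leqn0 -qj0.
  (* A requester without scrips has the lowest price of all, so the forgone gain is at most
     [w <= 1]. *)
  rewrite eqxx /=; apply: (@le_trans _ _ 1); last by lra.
  apply: gain_le => // k kD.
  have := @price_le q tau.1 k; rewrite qj0 => /(_ isT). lra.
rewrite orbF => rej; apply: le_trans (addr_ge0 E_ge0 e_ge0).
apply: gain_le => // k kD.
have : inf [set price q k' | k' in [set` compat M tau]] <= price q k.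
  apply: ge_inf; last by exists k.
  by exists (price q i0) => _ [k' _ <-]; exact: price_le.
by move: rej; rewrite -/(price _ _); lra.
Qed.

(** Instance of [error_tradeoff]. The price of [i0] is [- sm * rho] and the largest price is at
    least [- m], so the spread exceeds [2 * m] by at least [sm * rho - 3 * m]. *)
Lemma mbp_dual_error (q : St) i0 :
  let al : R := alpha (demand M) (phi M) pickup (compat M) in
  (0 < #|V|)%N -> 0 < al -> Omega K q -> (forall i, (q i0 <= q i)%N) ->
  1297 * m ^+ 2 <= K%:R -> 64 <= al ^+ 2 * K%:R -> 256 <= al ^+ 4 * K%:R ->
  dual_inf M <= dual M (price q) -
    (2 * sm * (root_balance q i0)^-1 ^+ 3 / Kt + (q i0 == 0%N)%:R)
    + 432 * m ^+ 2 / K%:R.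
Proof.
move=> al V0 al0 qK q0P K1 K2 K3.
have al_ge0 := ltW al0; have sK_ge0 := ltW sK_gt0.
have rho_gt0 i : 0 < (root_balance q i)^-1 by rewrite invr_gt0 root_balance_gt0.
have m1 : 1 <= m by rewrite ler1n.
have sm1 : 1 <= sm by rewrite -sqrtr1 ler_wsqrtr.
have rhoE : (root_balance q i0)^-1 ^+ 2 * sK = Kt * (sK / ((q i0)%:R + sK)).
  by rewrite exprVn sqr_root_balance invf_div; ring.
have [v _] := card_gt0P V0.
have [i1 _ i1P] := @arg_maxnP _ v xpredT q erefl.
have [spread d0] := (dual_ge_spread M (price q) i0 i1 al_ge0,
                     dual_inf_le_dual M (price q) al_ge0 V0).
(* The balances sum to 1, so the fullest agent has at least the average [1 / m], whose inverse root
   is [sm]. *)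
have price1 : - m <= price q i1.
  rewrite priceE lerN2 -[leRHS]sqr_sm expr2 ler_wpM2l//.
  rewrite -[leRHS]invrK lef_pV2 ?posrE ?invr_gt0
    ?root_balance_gt0 ?(lt_le_trans ltr01)//.
  rewrite -[leLHS]ger0_norm ?invr_ge0// -sqrtr_sqr ler_wsqrtr// exprVn sqr_sm.
  rewrite -[leLHS]mulr1 ler_pdivrMl ?(lt_le_trans ltr01)//.
  rewrite -(sum_normalized_balance _ qK).
  rewrite mulr_natl -sumr_const; apply: ler_sum => i _.
  rewrite ler_wpM2r ?invr_ge0 ?(ltW Kt_gt0)// lerD2r ler_nat.
  exact: i1P.
have := @error_tradeoff R m sm sK al (root_balance q i0)^-1
  (dual M (price q) - dual_inf M) (q i0 == 0%N).
rewrite sqr_sK -/Kt => /(_ sm1 sqr_sm sK_gt0 al0 (rho_gt0 _)).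
suff H : 0 <= dual M (price q) - dual_inf M /\ [/\ 1297 * m ^+ 2 <= K%:R,
    8 <= al * sK, 16 <= al ^+ 2 * sK,
    al * (sm * (root_balance q i0)^-1 - 3 * m) <= dual M (price q) - dual_inf M &
    (root_balance q i0)^-1 ^+ 2 * sK <= Kt] /\
    (q i0 == 0%N -> (root_balance q i0)^-1 ^+ 2 * sK = Kt).
  by case: H => h1 [[h2 h3 h4 h5 h6] h7] /(_ h1 h2 h3 h4 h5 h6 h7); lra.
split; first by rewrite subr_ge0.
split; last first.
  move=> /eqP q00; rewrite rhoE q00 add0r divff ?mulr1//.
  by rewrite gt_eqF.
split => //.
(* The thresholds 64 and 256 are the squares of the 8 and 16 in [error_tradeoff], with
   [sK ^+ 2 = K]. *)
- rewrite -(@ler_sqr _ 8) ?nnegrE ?mulr_ge0// exprMn sqr_sK; lra.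
- rewrite -(@ler_sqr _ 16) ?nnegrE ?mulr_ge0 ?exprn_ge0// exprMn sqr_sK -exprM; lra.
- rewrite lerBrDl; apply: le_trans (spread _); last first.
    by move=> i; rewrite !price_le ?q0P//; exact: i1P.
  rewrite lerD2l ler_pM2l// [price q i0]priceE; move: price1; rewrite -/m; lra.
- rewrite rhoE -[leRHS]mulr1 ler_pM2l// ler_pdivrMr ?mul1r ?lerDr//.
  by rewrite ltr_wpDl.
Qed.

(** [history_mean_drift] for the negated payoff and the negated potential. The potential varies by
    at most [2 * Kt * m], and [Kt <= 2 * K] because [m <= sK]. *)
Lemma average_payoff_ge (pi : policy (R := R) (V := V) (Sigma := Sigma)) T q1 :
  let al : R := alpha (demand M) (phi M) pickup (compat M) in
  (0 < #|V|)%N -> 0 < al ->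
  1297 * m ^+ 2 <= K%:R -> 64 <= al ^+ 2 * K%:R -> 256 <= al ^+ 4 * K%:R ->
  is_MBP M K (congestion #|V|) pi -> Omega K q1 -> (0 < T)%N ->
  dual_inf M - 432 * m ^+ 2 / K%:R - 4 * m * (K%:R / T%:R) <=
  average_payoff M pi T q1.
Proof.
move=> al V0 al0 K1 K2 K3 [piF piMBP] q1K T0.
have T0' : 0 < T%:R :> R by rewrite ltr0n.
have K0' : 0 < K%:R :> R by rewrite ltr0n.
have Kt2 : Kt <= 2 * K%:R.
  suff : m * sK <= K%:R by rewrite /Kt; lra.
  rewrite -sqr_sK expr2 ler_pM2r// -(@ler_sqr _ m) ?nnegrE ?(ltW sK_gt0)//.
  by rewrite sqr_sK; have := sqr_ge0 m; lra.
rewrite average_payoffE ler_pdivlMl//.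
have mean_opp : history_mean M pi q1 T (fun h => \sum_(e <- h) - payoff M e) =
    - history_mean M pi q1 T (fun h => \sum_(e <- h) payoff M e).
  by rewrite -sumrN; apply: eq_bigr => s _; rewrite sumrN mulrN.
have : history_mean M pi q1 T (fun h => \sum_(e <- h) - payoff M e) <=
    T%:R * (- dual_inf M + 432 * m ^+ 2 / K%:R) + 2 * Kt * m.
  apply: (history_mean_drift M pi piF K _ (fun q => - potential q)) => //.
    move=> h q qK; have [v _] := card_gt0P V0.
    have [i0 _ i0P] := @arg_minnP _ v xpredT q erefl.
    have {}i0P i : (q i0 <= q i)%N by exact: i0P.
    have := mbp_dual_error q i0 V0 al0 qK i0P K1 K2 K3.
    set err : R := (X in _ - X + _) => dq.
    rewrite -[leLHS]opprK -sumrN lerNl opprD opprK.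
    apply: (@le_trans _ _ (dual M (price q) - err)).
      by move: dq; lra.
    rewrite -[err]mul1r -(phi_sum1 M) mulr_suml -sumrB.
    under eq_bigr do rewrite -mulrBr.
    rewrite -(sum_event_prob M pi piF q1 h (fun tau => gain M (price q) tau - err)).
    apply: ler_sum => e _; rewrite -mulrN.
    have [->|/(event_prob_gt0 M pi piF)[eD pi0]] := eqVneq (event_prob M pi q1 h e) 0.
      by rewrite !mul0r.
    rewrite ler_wpM2l ?event_prob_ge0//.
    have := mbp_step q i0 _ _ i0P eD (piMBP _ _ _ _ eD pi0).
    by rewrite -surjective_pairing -/err; lra.
  by move=> q q' /potential_bounds/andP[? _] /potential_bounds/andP[_ ?]; lra.
rewrite mean_opp => H.
have -> : T%:R * (dual_inf M - 432 * m ^+ 2 / K%:R - 4 * m * (K%:R / T%:R)) =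
    T%:R * (dual_inf M - 432 * m ^+ 2 / K%:R) - 4 * m * K%:R.
  by field; rewrite !gt_eqF.
by have := ler_wpM2r m_ge0 Kt2; lra.
Qed.

End MBPDrift.

(** * From bounds on average payoffs to the losses, at finite horizon and in the limit *)

Lemma bounded_fun_itv (R : realType) (u : R^o ^nat) (a b : R) :
  (forall n, a <= u n <= b) -> bounded_fun u.
Proof.
move=> uab; exists (`|a| + `|b|); split; first exact: num_real.
move=> x abx n _; have /andP[an bn] := uab n.
apply: le_trans (ltW abx); rewrite ler_norml; apply/andP; split.
  by have := lerNnormlW (lexx `|a|); have := normr_ge0 b; lra.
by have := ler_norm b; have := normr_ge0 a; lra.
Qed.

Lemma exists_div_le (R : realType) (b e : R) : 0 <= b -> 0 < e ->
  exists2 n, (0 < n)%N & forall k, (n <= k)%N -> b / k%:R <= e.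
Proof.
move=> b0 e0; exists (Num.trunc (b / e)).+1 => // k nk.
have k0 : 0 < k%:R :> R by rewrite ltr0n (leq_trans _ nk).
rewrite ler_pdivrMr// mulrC -ler_pdivrMr//.
have /andP[_ /ltW be] := trunc_itv (divr_ge0 b0 (ltW e0)).
by apply: le_trans be _; rewrite ler_nat.
Qed.

Lemma limn_sup_le (R : realType) (u : R^o ^nat) (b c : R) : bounded_fun u ->
  0 <= b -> (forall n, (0 < n)%N -> u n <= c + b / n%:R) -> limn_sup u <= c.
Proof.
move=> ub b0 uc; rewrite limn_supE//; apply/ler_addgt0Pr => e e0.
have [n n0 nP] := exists_div_le R b e b0 e0.
apply: (@le_trans _ _ (sups u n)).
  by apply: ge_inf; [exact: bounded_fun_has_lbound_sups|exists n].
apply: ge_sup => [|_ [k /= nk <-]]; first by exists (u n), n => /=.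
by apply: le_trans (uc _ (leq_trans n0 nk)) _; rewrite lerD2l nP.
Qed.

Lemma limn_inf_ge (R : realType) (u : R^o ^nat) (b c : R) : bounded_fun u ->
  0 <= b -> (forall n, (0 < n)%N -> c - b / n%:R <= u n) -> c <= limn_inf u.
Proof.
move=> ub b0 uc; rewrite limn_infE//; apply/ler_addgt0Pl => e e0.
have [n n0 nP] := exists_div_le R b e b0 e0.
rewrite -lerBlDl; apply: (@le_trans _ _ (infs u n)); last first.
  by apply: ub_le_sup; [exact: bounded_fun_has_ubound_infs|exists n].
apply: lb_le_inf => [|_ [k /= nk <-]]; first by exists (u n), n => /=.
by apply: le_trans (uc _ (leq_trans n0 nk)); rewrite lerD2l lerN2 nP.
Qed.

Lemma ler_div_nat (R : realFieldType) (b : R) (T : nat) :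
  0 <= b -> (0 < T)%N -> b / T%:R <= b.
Proof.
by move=> b0 T0; rewrite ler_piMr// invf_le1 ?ltr0n// ler1n.
Qed.

Section OptimalWelfare.
Context {R : realType} {V Sigma : finType}.
Variables (M : scrip_system R V Sigma) (K : nat).
Variable pi : policy (R := R) (V := V) (Sigma := Sigma).
Hypotheses (V0 : (0 < #|V|)%N) (pi_feasible : feasible M pi).

Variables (g A B c : R).
Hypotheses (A0 : 0 <= A) (B0 : 0 <= B).
Hypothesis upper : forall rho T q, feasible M rho -> Omega K q -> (0 < T)%N ->
  average_payoff M rho T q <= g + A / T%:R.
Hypothesis lower : forall T q, Omega K q -> (0 < T)%N ->
  g - c - B / T%:R <= average_payoff M pi T q.

Lemma Omega_neq0 : @Omega V K !=set0.
Proof.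
have [v _] := card_gt0P V0; exists [ffun i => if i == v then K else 0%N].
rewrite /Omega /= (bigD1 v)//= ffunE eqxx big1 ?addn0// => i /negbTE iv.
by rewrite ffunE iv.
Qed.

Lemma sup_average_le rho T : feasible M rho -> (0 < T)%N ->
  sup [set average_payoff M rho T q | q in Omega K] <= g + A / T%:R.
Proof.
move=> rhoF T0; apply: ge_sup => [|_ [q qK <-]]; last exact: upper.
by have [q qK] := Omega_neq0; exists (average_payoff M rho T q), q.
Qed.

Lemma Wstar_T_le T : (0 < T)%N -> Wstar_T M K T <= g + A / T%:R.
Proof.
move=> T0; apply: ge_sup => [|_ [rho rhoF <-]]; last exact: sup_average_le.
by exists (sup [set average_payoff M pi T q | q in Omega K]), pi.
Qed.

Lemma W_T_ge T : (0 < T)%N -> g - c - B / T%:R <= W_T M K pi T.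
Proof.
move=> T0; apply: lb_le_inf => [|_ [q qK <-]]; last exact: lower.
by have [q qK] := Omega_neq0; exists (average_payoff M pi T q), q.
Qed.

(** With [W_T_le_average] this bounds [Wstar_T] from below and [W_T] from above, giving the
    boundedness that the limits in [L_le] require. *)
Lemma average_le_Wstar_T T q : (0 < T)%N -> Omega K q ->
  average_payoff M pi T q <= Wstar_T M K T.
Proof.
move=> T0 qK.
apply: (@le_trans _ _ (sup [set average_payoff M pi T q | q in Omega K])).
  apply: ub_le_sup; last by exists q.
  by exists (g + A / T%:R) => _ [q' q'K <-]; exact: upper.
apply: ub_le_sup; last by exists pi.
by exists (g + A / T%:R) => _ [rho rhoF <-]; exact: sup_average_le.
Qed.

Lemma W_T_le_average T q : (0 < T)%N -> Omega K q ->
  W_T M K pi T <= average_payoff M pi T q.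
Proof.
move=> T0 qK; apply: ge_inf; last by exists q.
by exists (g - c - B / T%:R) => _ [q' q'K <-]; exact: lower.
Qed.

Lemma L_T_le T : (0 < T)%N -> L_T M K pi T <= (A + B) / T%:R + c.
Proof.
by move=> T0; rewrite /L_T; have := Wstar_T_le T T0; have := W_T_ge T T0; lra.
Qed.

Lemma L_le : L M K pi <= c.
Proof.
have [q qK] := Omega_neq0.
have Wb T : (0 < T)%N -> [/\ g - c - B <= W_T M K pi T, W_T M K pi T <= g + A,
    g - c - B <= Wstar_T M K T & Wstar_T M K T <= g + A].
  move=> T0.
  have := W_T_le_average T q T0 qK; have := average_le_Wstar_T T q T0 qK.
  have := Wstar_T_le T T0; have := W_T_ge T T0.
  by have := ler_div_nat R A T A0 T0; have := ler_div_nat R B T B0 T0; split; lra.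
(* The estimates concern positive horizons, so the value at horizon 0 enters the bounds through the
   minimum and maximum. *)
have bounded (u : R^o ^nat) :
    (forall T, (0 < T)%N -> g - c - B <= u T <= g + A) -> bounded_fun u.
  move=> uP; apply: (bounded_fun_itv R u
    (Num.min (u 0) (g - c - B)) (Num.max (u 0) (g + A))).
  case=> [|T]; first by rewrite ge_min le_max lexx.
  by have /andP[h1 h2] := uP T.+1 isT; rewrite ge_min le_max h1 h2 !orbT.
rewrite /L /W /Wstar.
have : limn_sup (Wstar_T M K) <= g.
  apply: (limn_sup_le R _ A) => //; last exact: Wstar_T_le.
  by apply: bounded => T /Wb[_ _ -> ->].
have : g - c <= limn_inf (W_T M K pi).
  apply: (limn_inf_ge R _ B) => //; last exact: W_T_ge.
  by apply: bounded => T /Wb[-> -> _ _].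
by lra.
Qed.

End OptimalWelfare.

(** * The threshold polynomial and the final constants *)

Lemma horner_threshold (R : comNzRingType) (a b c x y : R) :
  ((a%:P * 'X^2)%:P + b%:P%:P * 'X^2 + c%:P%:P * 'X^4).[x%:P].[y] =
  a * y ^+ 2 + b * x ^+ 2 + c * x ^+ 4.
Proof. by rewrite !(hornerE, horner_exp). Qed.

Theorem corollary2 (R : realType) :
  exists (P : {poly {poly R}}) (C : R), 0 < C /\
  forall (V Sigma : finType) (M : scrip_system R V Sigma),
    let m := #|V| in
    let al := alpha (demand M) (phi M) pickup (compat M) in
    let M1 := C * m%:R in
    let M2 := C * m%:R ^+ 2 in
    (1 < m)%N -> 0 < al ->
    forall (K : nat) (pi : policy (R := R) (V := V) (Sigma := Sigma)),
      P.[(al^-1)%:P].[m%:R] <= K%:R ->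
      is_MBP M K (congestion m) pi ->
      (forall T : nat, (0 < T)%N ->
         L_T M K pi T <= M1 * (K%:R / T%:R) + M2 * K%:R^-1) /\
      L M K pi <= M2 * K%:R^-1.
Proof.
(* The outer variable is the inverse of [al], the inner one is [m]. Each summand is one threshold of
   [average_payoff_ge], and the terms are nonnegative, so the sum dominates all three. The constant
   432 also covers the horizon terms, where [2 + 4] would do. *)
exists ((1297%:P * 'X^2)%:P + 64%:P%:P * 'X^2 + 256%:P%:P * 'X^4), 432.
split; first by rewrite ltr0n.
move=> V Sigma M m al M1 M2 m1 al0 K pi.
rewrite horner_threshold => PK piMBP; have [piF _] := piMBP.
have V0 : (0 < #|V|)%N by exact: ltnW m1.
have m0 : 0 < m%:R :> R by rewrite ltr0n.
have x2 : 0 <= 64 * al^-1 ^+ 2 by apply: mulr_ge0; [exact: ler0n|exact: sqr_ge0].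
have x4 : 0 <= 256 * al^-1 ^+ 4
  by apply: mulr_ge0; [exact: ler0n|rewrite exprn_ge0// invr_ge0 ltW].
have m2 : 0 < 1297 * m%:R ^+ 2 :> R
  by apply: mulr_gt0; [rewrite ltr0n|exact: exprn_gt0].
have K0 : (0 < K)%N by rewrite -(ltr0n R); lra.
have K1 : 1297 * m%:R ^+ 2 <= K%:R :> R by lra.
have K2 : 64 <= al ^+ 2 * K%:R.
  by rewrite -ler_pdivrMl ?exprn_gt0// mulrC -exprVn; lra.
have K3 : 256 <= al ^+ 4 * K%:R.
  by rewrite -ler_pdivrMl ?exprn_gt0// mulrC -exprVn; lra.
have up rho T q : feasible M rho -> Omega K q -> (0 < T)%N ->
    average_payoff M rho T q <= dual_inf M + 2 * m%:R * K%:R / T%:R.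
  by move=> rhoF qK T0; rewrite -mulrA average_payoff_le.
have low T q : Omega K q -> (0 < T)%N ->
    dual_inf M - 432 * m%:R ^+ 2 / K%:R - 4 * m%:R * K%:R / T%:R <=
    average_payoff M pi T q.
  by move=> qK T0; rewrite -[X in _ - X]mulrA average_payoff_ge.
have A0 : 0 <= 2 * m%:R * K%:R :> R by rewrite !mulr_ge0.
have B0 : 0 <= 4 * m%:R * K%:R :> R by rewrite !mulr_ge0.
split=> [T T0|]; last exact: (L_le M K pi V0 piF _ _ _ _ A0 B0 up low).
apply: le_trans (L_T_le M K pi V0 piF _ _ _ _ up low T T0) _.
rewrite lerD2r /M1 mulrA ler_wpM2r ?invr_ge0//.
by have : 0 <= m%:R * K%:R :> R by []; rewrite mulr_ge0//; lra.
Qed.
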